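(* Let $(M,d,\leq)$ be a Loewner-Heinz NPC space. Let $n\geq 2$ and let $\mathbf{w}=(w_1,\ldots,w_n)$ be a weight. Then the weighted least squares mean $\mathfrak{G}_n(\mathbf{w};\cdot):M^n\to M$ is monotonic: if $x_1,\ldots,x_n,y_1,\ldots,y_n\in M$ satisfy $x_i\leq y_i$ for $i=1,\ldots,n$, then $$\mathfrak{G}_n(\mathbf{w};x_1,\ldots,x_n)\leq \mathfrak{G}_n(\mathbf{w};y_1,\ldots,y_n).$$
   Context: An NPC space is a complete metric space $(M,d)$ such that for all $x,y\in M$ there exists $m\in M$ such that for all $z\in M$, $d^2(m,z)\leq \frac12 d^2(x,z)+\frac12 d^2(y,z)-\frac14 d^2(x,y)$ (also called a global CAT(0) space or Hadamard space). The point $m$ is then the unique metric midpoint of $x$ and $y$, denoted $x\# y$. A Loewner-Heinz NPC space $(M,d,\leq)$ is an NPC space $(M,d)$ equipped with a closed partial order $\leq$ (i.e. $\{(x,y): x\leq y\}$ is closed in $M\times M$) satisfying $x_1\# x_2\leq y_1\# y_2$ whenever $x_i\leq y_i$ for $i=1,2$. A weight is a tuple $\mathbf{w}=(w_1,\ldots,w_n)$ of positive real numbers with $\sum_{i=1}^n w_i=1$. The weighted least squares mean of $(a_1,\ldots,a_n)\in M^n$ is $\mathfrak{G}_n(\mathbf{w};a_1,\ldots,a_n)=\arg\min_{z\in M}\sum_{i=1}^n w_i d^2(z,a_i)$; in an NPC space the minimizer exists and is unique (known fact). *)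

(* Defs.v *)
From HB Require Import structures.
From mathcomp Require Import all_boot all_order all_algebra.
From mathcomp Require Import boolp classical_sets reals topology.
From mathcomp Require Import ring lra.

Set Implicit Arguments.
Unset Strict Implicit.
Unset Printing Implicit Defensive.

Import Order.TTheory GRing.Theory Num.Theory.
Import numFieldTopology.Exports.

Local Open Scope classical_set_scope.
Local Open Scope ring_scope.

(* The library's complete spaces carry a base point; this only excludes the
   empty space, which has no n-tuples of points for n > 0. *)
#[short(type="completeMetricType")]
HB.structure Definition CompleteMetric (R : numDomainType) :=
  { M of Metric R M & Complete M }.

Definition is_npc_midpoint (R : realType) (M : metricType R) (x y m : M) : Prop :=
  forall z : M, mdist m z ^+ 2 <=
    2^-1 * mdist x z ^+ 2 + 2^-1 * mdist y z ^+ 2 - 4^-1 * mdist x y ^+ 2.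

HB.mixin Record CompleteMetric_isNPC (R : realType) M & CompleteMetric R M := {
  npc_midpoint_ex : forall x y : M, exists m : M, is_npc_midpoint x y m
}.

#[short(type="npcType")]
HB.structure Definition NPC (R : realType) :=
  { M of CompleteMetric R M & CompleteMetric_isNPC R M }.

(* x # y *)
Definition midpoint (R : realType) (M : npcType R) (x y : M) : M :=
  get [set m | is_npc_midpoint x y m].

#[short(type="porderNPCType")]
HB.structure Definition POrderNPC (d : Order.disp_t) (R : realType) :=
  { M of NPC R M & Order.isPOrder d M }.

HB.mixin Record POrderNPC_isLoewnerHeinz (d : Order.disp_t) (R : realType) M
    & POrderNPC d R M := {
  le_closed : closed [set p : M * M | (p.1 <= p.2)%O] ;
  le_midpoint : forall x1 x2 y1 y2 : M, (x1 <= y1)%O -> (x2 <= y2)%O ->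
    (midpoint x1 x2 <= midpoint y1 y2)%O
}.

#[short(type="loewnerHeinzNPCType")]
HB.structure Definition LoewnerHeinzNPC (d : Order.disp_t) (R : realType) :=
  { M of POrderNPC d R M & POrderNPC_isLoewnerHeinz d R M }.

Definition is_weight (R : realType) (n : nat) (w : 'I_n -> R) : Prop :=
  (forall i, 0 < w i) /\ \sum_(i < n) w i = 1.

Definition ls_cost (R : realType) (M : npcType R) (n : nat) (w : 'I_n -> R)
    (a : 'I_n -> M) (z : M) : R :=
  \sum_(i < n) w i * mdist z (a i) ^+ 2.

Definition is_argmin (R : realType) (T : Type) (f : T -> R) (z : T) : Prop :=
  forall z', f z <= f z'.

Definition lsmean (R : realType) (M : npcType R) (n : nat) (w : 'I_n -> R)
    (a : 'I_n -> M) : M :=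
  get [set z | is_argmin (ls_cost w a) z].

(* get returns the base point when the set is empty; the lemmas below show that
   midpoint and lsmean (for a weight w) never fall in that case. *)
Lemma midpointP (R : realType) (M : npcType R) (x y : M) :
  is_npc_midpoint x y (midpoint x y).
Proof.
have [m hm] := npc_midpoint_ex x y.
exact: (@getPex _ [set m | is_npc_midpoint x y m] (ex_intro _ m hm)).
Qed.

Lemma npc_midpoint_mdist (R : realType) (M : npcType R) (x y m : M) :
  is_npc_midpoint x y m ->
  mdist m x = 2^-1 * mdist x y /\ mdist m y = 2^-1 * mdist x y.
Proof.
move=> hm; have := hm x; have := hm y.
rewrite !mdistxx (metric_sym y x).
have := metric_triangle x m y; rewrite (metric_sym x m).
have := mdist_ge0 m x; have := mdist_ge0 m y; have := mdist_ge0 x y.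
move: (mdist m x) (mdist m y) (mdist x y) => p q r r0 q0 p0 tri hy hx.
have hp : p <= 2^-1 * r.
  by rewrite -(@ler_pXn2r _ 2) ?nnegrE//; [nra | lra].
have hq : q <= 2^-1 * r.
  by rewrite -(@ler_pXn2r _ 2) ?nnegrE//; [nra | lra].
by split; lra.
Qed.

Lemma midpoint_unique (R : realType) (M : npcType R) (x y m : M) :
  mdist m x = 2^-1 * mdist x y -> mdist m y = 2^-1 * mdist x y ->
  m = midpoint x y.
Proof.
move=> hx hy; have := midpointP x y m.
rewrite (metric_sym x m) (metric_sym y m) hx hy => h.
apply/esym/mdist_positivity/eqP; rewrite -sqrf_eq0 eq_le sqr_ge0 andbT.
by nra.
Qed.

Section lsmean_well_defined.
Context (R : realType) (M : npcType R) (n : nat).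
Context (w : 'I_n -> R) (a : 'I_n -> M) (hw : is_weight w).
Let f := ls_cost w a.

Let f_ge0 z : 0 <= f z.
Proof. by apply: sumr_ge0 => i _; rewrite mulr_ge0 ?sqr_ge0// ltW//; case: hw. Qed.

Let f_midpoint x y :
  f (midpoint x y) <= 2^-1 * f x + 2^-1 * f y - 4^-1 * mdist x y ^+ 2.
Proof.
case: hw => w0 w1.
have -> : 4^-1 * mdist x y ^+ 2 = \sum_(i < n) 4^-1 * (w i * mdist x y ^+ 2).
  by rewrite -mulr_sumr -mulr_suml w1 mul1r.
rewrite /f /ls_cost !mulr_sumr -sumrN -!big_split/=; apply: ler_sum => i _.
rewrite [leRHS](_ : _ = w i * (2^-1 * mdist x (a i) ^+ 2 +
  2^-1 * mdist y (a i) ^+ 2 - 4^-1 * mdist x y ^+ 2)); last by ring.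
by apply: ler_wpM2l; [exact: ltW | exact: midpointP].
Qed.

Lemma lsmean_argmin_unique x y : is_argmin f x -> is_argmin f y -> x = y.
Proof.
move=> hx hy; apply/mdist_positivity/eqP; rewrite -sqrf_eq0 eq_le sqr_ge0 andbT.
have := f_midpoint x y; have := hx (midpoint x y); have := hx y; have := hy x.
by lra.
Qed.

Import metricType_numDomainType.

Let near_cost l e : 0 < e -> \forall z \near l, f l <= f z + e.
Proof.
case: hw => w0 w1 e0.
pose D := \sum_(i < n) mdist l (a i).
have D0 : 0 <= D by apply: sumr_ge0 => i _; exact: mdist_ge0.
have De : 0 < e / (2 * D + 1) by rewrite divr_gt0//; lra.
apply/nbhs_mdistP; exists (e / (2 * D + 1)) => //= z /= lz.
rewrite -(mulr1 e) -w1 mulr_sumr /f /ls_cost -big_split/=; apply: ler_sum => i _.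
rewrite (mulrC e) -mulrDr; apply: ler_wpM2l; first exact: ltW.
have lD : mdist l (a i) <= D.
  by rewrite /D (bigD1 i)//= lerDl sumr_ge0// => j _; exact: mdist_ge0.
have tri := metric_triangle l z (a i).
have p0 := mdist_ge0 l (a i); have q0 := mdist_ge0 z (a i).
have d0 := mdist_ge0 l z.
have {}lz : mdist l z * (2 * D + 1) < e by rewrite -ltr_pdivlMr//; lra.
move: (mdist l (a i)) (mdist z (a i)) (mdist l z) lD tri p0 q0 d0 lz.
move=> p q r pD tri p0 q0 r0 rD.
have [pq|qp] := leP p q; first by nra.
have rp : r * p <= r * D by rewrite ler_wpM2l.
have : (p - q) * (p + q) <= r * (2 * p).
  by apply: ler_pM; lra.
by nra.
Qed.

Lemma lsmean_argmin_ex : exists z, is_argmin f z.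
Proof.
case: (hw) => w0 w1.
have x0 : M := point.
pose L := inf (range f).
have fL z : L <= f z.
  by apply: ge_inf; [exists 0 => _ [y _ <-] | exists z].
have Lf e : 0 < e -> exists z, f z < L + e.
  move=> e0; have [] := @inf_adherent _ (range f) e e0.
    by split; [exists (f x0), x0 | exists 0 => _ [y _ <-]].
  by move=> _ [z _ <-] zL; exists z.
pose F := filter_from [set e : R | 0 < e] (fun e => [set z | f z < L + e]).
have FF : ProperFilter F.
  apply: filter_from_proper; last by move=> e /= /Lf.
  apply: filter_from_filter; first by exists 1 => /=.
  move=> i j /= i0 j0; exists (Order.min i j); first by rewrite /= lt_min i0.
  by move=> z /=; rewrite -ltrBlDl lt_min !ltrBlDl => /andP[].
have Fc : cauchy F.
  apply: (@cauchy_exP R) => e e0.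
  have e4 : 0 < e ^+ 2 / 4 by rewrite divr_gt0// exprn_gt0.
  have [x xL] := Lf _ e4; exists x, (e ^+ 2 / 4) => //= z /= zL.
  rewrite ballEmdist/= -(@ltr_pXn2r _ 2) ?nnegrE ?mdist_ge0// ?ltW//.
  by have := f_midpoint x z; have := fL (midpoint x z); lra.
pose l := lim F; have Fl : F --> l by exact: cauchy_cvg.
exists l => z; apply: le_trans (fL z); apply/ler_addgt0Pr => e e0.
have e2 : 0 < e / 2 by rewrite divr_gt0.
have Fn : F [set y | f l <= f y + e / 2] by apply: Fl; exact: near_cost.
have Fe : F [set y | f y < L + e / 2] by exists (e / 2).
by have [y [/= ? ?]] := filter_ex (filterI Fn Fe); lra.
Qed.

Lemma lsmeanP : is_argmin f (lsmean w a).
Proof. by have [z hz] := lsmean_argmin_ex; exact: (@getPex _ [set z | is_argmin f z] (ex_intro _ z hz)). Qed.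

End lsmean_well_defined.

(* Main.v *)
Require Import Defs.
From HB Require Import structures.
From mathcomp Require Import all_boot all_order all_algebra.
From mathcomp Require Import boolp classical_sets reals topology.
From mathcomp Require Import ring lra.

(** Write g and h for the two means and call a pair (p, q) with p <= q
    ordered. By closedness of the order it suffices to find ordered pairs
    arbitrarily close to (g, h), that is, with
    Phi(p, q) := d(p, g)^2 + d(q, h)^2 arbitrarily small.

    Moving p and q by the same fraction t of the way towards x_i and y_i keeps
    the pair ordered: for t = 2^-k the move is an iterated midpoint
    ([dyadic_step_le]). By the NPC inequality ([dyadic_step_npc]) it replaces
    Phi by at most
      (1 - t) Phi + t c_i + t^2 (d(p, x_i)^2 + d(q, y_i)^2),
    where
      c_i = (d(x_i, g)^2 - d(p, x_i)^2) + (d(y_i, h)^2 - d(q, y_i)^2).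
    The weighted average of the c_i is the excess of the two costs at the
    minimizers g and h over those at p and q, hence at most 0, so some index i
    has c_i <= 0. Moving towards that one index shrinks Phi by the factor 1 - t
    up to an error of order t^2 ([descent_step]). If the infimum of Phi over
    ordered pairs were positive, such a step from an almost minimal pair with
    t small would go below the infimum ([descent_inf]). So the infimum is 0.

    This greedy choice of the index is a deterministic substitute for the
    random choice, with law w, that underlies the proof by the law of large
    numbers: a quantity that does not increase on average does not increase for
    some outcome. Choosing one index for the sum of both terms of Phi keeps the
    two walks synchronized, and so ordered. *)

Set Implicit Arguments.
Unset Strict Implicit.
Unset Printing Implicit Defensive.

Import Order.TTheory GRing.Theory Num.Theory.
Import metricType_numDomainType.

Local Open Scope classical_set_scope.
Local Open Scope ring_scope.

Lemma dyadic_lt (R : realType) (e : R) : 0 < e -> exists k, 2^-1 ^+ k < e.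
Proof.
move=> e0; exists (Num.bound e^-1).
rewrite exprVn invf_plt ?posrE ?exprn_gt0//.
exact: upper_nthrootP.
Qed.

Lemma weighted_sum_le0 (R : realType) (n : nat) (w c : 'I_n -> R) :
  is_weight w -> \sum_(i < n) w i * c i <= 0 -> exists i, c i <= 0.
Proof.
move=> [w0 w1] s0; apply: contrapT => /forallNP c0.
have wc i : 0 < w i * c i.
  by rewrite mulr_gt0//; have /negP := c0 i; rewrite -ltNge.
have s_eq0 : \sum_(i < n) w i * c i = 0.
  by apply/eqP; rewrite eq_le s0 sumr_ge0// => i _; exact: ltW.
have wc_eq0 := psumr_eq0P (fun i _ => ltW (wc i)) s_eq0.
have : \sum_(i < n) w i = 0.
  by rewrite big1// => i _; have := wc i; rewrite wc_eq0// ltxx.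
by rewrite w1 => /eqP; rewrite oner_eq0.
Qed.

(** The gain t s is of first order in t = 2^-k and the loss of second order, so
    a positive infimum would be undercut by a step from an almost minimal s. The
    order of quantifiers matters: C is uniform in s and k, hence k can be chosen
    from the infimum alone, and s afterwards, close enough for that k. *)
Lemma descent_inf (R : realType) (S : set R) (C : R) :
  S !=set0 -> (forall s, S s -> 0 <= s) -> 0 <= C ->
  (forall s k, S s -> let t := 2^-1 ^+ k in
     exists2 s', S s' & s' <= (1 - t) * s + t ^+ 2 * (2 * s + 2 * C)) ->
  forall e, 0 < e -> exists2 s, S s & s < e.
Proof.
move=> Sn S0 C0 step e e0.
have Si : has_inf S by split => //; exists 0.
have adh b : inf S < b -> exists2 s, S s & s < b.
  rewrite -subr_gt0 => /inf_adherent -/(_ _ Si)[s Ss sb].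
  by exists s => //; move: sb; rewrite subrKC.
have [/adh//|Ie] := ltP (inf S) e.
set I := inf S in adh Ie *.
have I0 : 0 < I by apply: lt_le_trans Ie.
pose K := 2 * (I + 1) + 2 * C.
have K0 : 0 < K by rewrite /K; lra.
have [k] : exists k, 2^-1 ^+ k < Num.min (1 / I) (I / (4 * K)).
  by apply: dyadic_lt; rewrite lt_min !divr_gt0//; lra.
rewrite lt_min !ltr_pdivlMr ?mulr_gt0//.
set t := _ ^+ k => /andP[tI tK].
have t0 : 0 < t by rewrite exprn_gt0// invr_gt0.
(* An excess of t I / 2 over the infimum is half of the gain t I; the error
   t^2 K takes at most another quarter of it. *)
have [s Ss sI] : exists2 s, S s & s < I + t * I / 2.
  by apply: adh; rewrite ltrDl divr_gt0 ?mulr_gt0.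
have Is : I <= s by apply: ge_inf => //; case: Si.
have [s' Ss' s's] := step s k Ss.
have Is' : I <= s' by apply: ge_inf => //; case: Si.
have tts : t ^+ 2 * (2 * s + 2 * C) <= t * (I / 4).
  rewrite expr2 -mulrA ler_pM2l//.
  have : t * (2 * s + 2 * C) <= t * K by rewrite ler_pM2l// /K; lra.
  by lra.
have tsI : t * I <= t * s by rewrite ler_pM2l.
have tI0 : 0 < t * I by rewrite mulr_gt0.
by rewrite -/t in s's; lra.
Qed.

Section npc.
Context (R : realType) (M : npcType R).
Implicit Types x a z g : M.

(** The point at parameter 2^-k on the geodesic from x to a. *)
Fixpoint dyadic_step (k : nat) x a : M :=
  if k is k'.+1 then midpoint x (dyadic_step k' x a) else a.

(** The induction needs d(x, m) >= t d(x, a) for the point m at parameter t.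
    Taking z = a in the inequality for m gives d(m, a) <= (1 - t) d(x, a), and
    the triangle inequality concludes. *)
Lemma dyadic_step_npc k x a z : let t : R := 2^-1 ^+ k in
  mdist (dyadic_step k x a) z ^+ 2 <=
    (1 - t) * mdist x z ^+ 2 + t * mdist a z ^+ 2
    - t * (1 - t) * mdist x a ^+ 2.
Proof.
elim: k z => [|k IH] z /=; first by rewrite expr0 subrr !mul0r mulr0; lra.
move: IH => /=; set m := dyadic_step k x a; rewrite (exprS 2^-1).
have t0 : 0 <= 2^-1 ^+ k :> R by rewrite exprn_ge0// invr_ge0.
have t1 : 2^-1 ^+ k <= 1 :> R by rewrite exprn_ile1//; lra.
move: (2^-1 ^+ k) t0 t1 => t t0 t1 IH.
have ma : mdist m a <= (1 - t) * mdist x a.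
  rewrite -(@ler_pXn2r _ 2) ?nnegrE ?mulr_ge0 ?mdist_ge0 ?subr_ge0//.
  by have := IH a; rewrite mdistxx exprMn; lra.
have xm : (t * mdist x a) ^+ 2 <= mdist x m ^+ 2.
  rewrite ler_pXn2r ?nnegrE ?mulr_ge0 ?mdist_ge0//.
  by have := metric_triangle x m a; lra.
have := midpointP x m z; have := IH z; move: xm.
by rewrite exprMn; lra.
Qed.

Lemma mdist_sqr_le x g a :
  mdist x a ^+ 2 <= 2 * mdist x g ^+ 2 + 2 * mdist g a ^+ 2.
Proof.
have tri := metric_triangle x g a.
have : mdist x a ^+ 2 <= (mdist x g + mdist g a) ^+ 2.
  by rewrite ler_pXn2r ?nnegrE ?addr_ge0 ?mdist_ge0.
by have := sqr_ge0 (mdist x g - mdist g a); lra.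
Qed.

End npc.

Section ordered_pairs.
Context (d : Order.disp_t) (R : realType) (M : loewnerHeinzNPCType d R).

Lemma dyadic_step_le k (p q a b : M) : (p <= q)%O -> (a <= b)%O ->
  (dyadic_step k p a <= dyadic_step k q b)%O.
Proof. by move=> pq ab; elim: k => [|k IH] //=; exact: le_midpoint. Qed.

Definition sqr_dist2 (g h p q : M) : R := mdist p g ^+ 2 + mdist q h ^+ 2.

Lemma sqr_dist2_ge0 g h p q : 0 <= sqr_dist2 g h p q.
Proof. by rewrite addr_ge0 ?sqr_ge0. Qed.

Lemma le_closed_approx (g h : M) :
  (forall e, 0 < e -> exists p q, (p <= q)%O /\ sqr_dist2 g h p q < e) ->
  (g <= h)%O.
Proof.
move=> near_gh; apply: (@le_closed d R M (g, h)) => B [[U V]] /= [].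
move=> /nbhs_mdistP[e /= e0 eU] /nbhs_mdistP[e' /= e'0 e'V] UVB.
pose r := Num.min e e'.
have r0 : 0 < r by rewrite lt_min e0.
have [p [q [pq]]] := near_gh (r ^+ 2) (exprn_gt0 2 r0).
have := sqr_ge0 (mdist p g); have := sqr_ge0 (mdist q h).
rewrite /sqr_dist2 => q0 p0 pqr.
have : mdist p g < r.
  by rewrite -(@ltr_pXn2r _ 2) ?nnegrE ?mdist_ge0 ?(ltW r0)//; lra.
have : mdist q h < r.
  by rewrite -(@ltr_pXn2r _ 2) ?nnegrE ?mdist_ge0 ?(ltW r0)//; lra.
rewrite !lt_min => /andP[_ qh] /andP[pg _].
exists (p, q); split => //; apply: UVB; split => /=.
- by apply: eU => /=; rewrite metric_sym.
- by apply: e'V => /=; rewrite metric_sym.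
Qed.

Context (n : nat) (w : 'I_n -> R) (x y : 'I_n -> M).
Context (hw : is_weight w) (hxy : forall i, (x i <= y i)%O).
Context (g h : M).
Context (g_min : is_argmin (ls_cost w x) g).
Context (h_min : is_argmin (ls_cost w y) h).

(** The weighted sums of the two sides over i are the total costs at (g, h) and
    at (p, q), so the inequality cannot fail for every i. *)
Lemma descent_index p q : exists i,
  sqr_dist2 (x i) (y i) g h <= sqr_dist2 (x i) (y i) p q.
Proof.
pose c i := sqr_dist2 (x i) (y i) g h - sqr_dist2 (x i) (y i) p q.
have [|i] := @weighted_sum_le0 R n w c hw; last first.
  by rewrite subr_le0; exists i.
have -> : \sum_(i < n) w i * c i = ls_cost w x g + ls_cost w y h
                                   - (ls_cost w x p + ls_cost w y q).
  rewrite /ls_cost -!big_split -sumrB/=; apply: eq_bigr => i _.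
  by rewrite /c /sqr_dist2; ring.
by rewrite subr_le0 lerD.
Qed.

(** A bound for the distances from (g, h) to the data that does not depend on
    the index picked in [descent_index]; the step length in [descent_inf] has to
    be fixed before the pair, and so before that index, is known. *)
Let C := \sum_(i < n) sqr_dist2 (x i) (y i) g h.

(** For the index i of [descent_index] the first-order term of the NPC
    inequalities is at most -t Phi. The remaining second-order term is
    t^2 (d(p, x_i)^2 + d(q, y_i)^2), and
    d(p, x_i)^2 <= 2 d(p, g)^2 + 2 d(g, x_i)^2. *)
Lemma descent_step p q k : (p <= q)%O -> let t := 2^-1 ^+ k in
  exists p' q', (p' <= q')%O /\
    sqr_dist2 g h p' q' <= (1 - t) * sqr_dist2 g h p q
                           + t ^+ 2 * (2 * sqr_dist2 g h p q + 2 * C).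
Proof.
move=> pq t; have [i ci] := descent_index p q.
exists (dyadic_step k p (x i)), (dyadic_step k q (y i)).
split; first exact: dyadic_step_le.
have t0 : 0 <= t by rewrite exprn_ge0// invr_ge0.
have iC : sqr_dist2 (x i) (y i) g h <= C.
  rewrite /C (bigD1 i)//= lerDl sumr_ge0// => j _; exact: sqr_dist2_ge0.
have K : sqr_dist2 (x i) (y i) p q <= 2 * sqr_dist2 g h p q + 2 * C.
  have := mdist_sqr_le p g (x i); have := mdist_sqr_le q h (y i).
  by move: iC; rewrite /sqr_dist2; lra.
have := dyadic_step_npc k p (x i) g; have := dyadic_step_npc k q (y i) h.
rewrite -/t (metric_sym (x i)) (metric_sym (y i)).
have := ler_wpM2l t0 ci; have := ler_wpM2l (sqr_ge0 t) K.
by rewrite /sqr_dist2; lra.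
Qed.

Lemma argmin_le : (g <= h)%O.
Proof.
apply: le_closed_approx => e e0.
pose S := [set s | exists p q, (p <= q)%O /\ sqr_dist2 g h p q = s].
have [||||_ [p [q [pq <-]]] pqe] := @descent_inf R S C _ _ _ _ e e0.
- by exists (sqr_dist2 g h g g), g, g.
- by move=> _ [p [q [_ <-]]]; exact: sqr_dist2_ge0.
- by apply: sumr_ge0 => i _; exact: sqr_dist2_ge0.
- move=> _ k [p [q [pq <-]]].
  have [p' [q' [p'q' le']]] := descent_step k pq.
  by exists (sqr_dist2 g h p' q') => //; exists p', q'.
- by exists p, q.
Qed.

End ordered_pairs.

Theorem theorem6p3 (R : realType) (d : Order.disp_t)
    (M : loewnerHeinzNPCType d R) (n : nat) (hn : (2 <= n)%N)
    (w : 'I_n -> R) (hw : is_weight w) (x y : 'I_n -> M)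
    (hxy : forall i : 'I_n, (x i <= y i)%O) :
  (lsmean w x <= lsmean w y)%O.
Proof. by apply: (argmin_le hw hxy); exact: lsmeanP. Qed.
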